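(* Let $4\le p\le n-1$ and let $S\subset V$ with $0,n\in S$. The min-cut inequality $x((S:V\setminus S))\ge 1$ is valid for $P^p_{0,n}(D)$ if and only if $|S|\le p$, and it is facet defining for $P^p_{0,n}(D)$ if and only if $3\le |S|\le p$ and $|V\setminus S|\ge 2$.
   Context: Let $n$ be a positive integer, $V=\{0,1,\dots,n\}$, and let $D=(V,A)$ be the digraph whose arc set $A$ consists of all ordered pairs $(i,j)$ with $i\neq j$, $i,j\in V$, except that no arc enters node $0$, no arc leaves node $n$, and the arc $(0,n)$ is absent. A $(0,n)$-$p$-path is a simple directed path in $D$ from $0$ to $n$ with exactly $p$ arcs. $P^p_{0,n}(D)\subseteq\mathbb{R}^A$ is the convex hull of the incidence vectors of all $(0,n)$-$p$-paths. For $F\subseteq A$, $x(F)=\sum_{(i,j)\in F}x_{ij}$. For node sets $S,T$, $(S:T)=\{(i,j)\in A: i\in S, j\in T\}$. Facet defining means valid and defining a face of dimension $\dim P^p_{0,n}(D)-1$. *)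

(* Defs.v *)
From HB Require Import structures.
From mathcomp Require Import all_boot all_order all_algebra.
Set Implicit Arguments. Unset Strict Implicit. Unset Printing Implicit Defensive.
Import Order.TTheory GRing.Theory Num.Theory.
Local Open Scope ring_scope.

(* Nodes V = {0,...,n} are 'I_n.+1; node 0 is ord0, node n is ord_max. *)

Definition is_arc (n : nat) (ij : 'I_n.+1 * 'I_n.+1) : bool :=
  [&& ij.1 != ij.2, ij.2 != ord0, ij.1 != ord_max
    & ~~ ((ij.1 == ord0) && (ij.2 == ord_max))].

Definition arc (n : nat) := {ij : 'I_n.+1 * 'I_n.+1 | is_arc ij}.

(* A (0,n)-p-path given by its node sequence 0 :: t: a simple directed path
   in D from 0 to n with exactly p arcs. *)
Definition is_p_path (n p : nat) (t : seq 'I_n.+1) : bool :=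
  [&& path (fun i j => is_arc (i, j)) ord0 t,
      last ord0 t == ord_max,
      uniq (ord0 :: t) & size t == p].

Definition incidence (R : nzRingType) (n : nat) (t : seq 'I_n.+1) : arc n -> R :=
  fun a => if val a \in zip (ord0 :: t) t then 1 else 0.

Definition conv (R : realFieldType) (T : Type) (X : (T -> R) -> Prop) :
  (T -> R) -> Prop :=
  fun x => exists (k : nat) (lam : 'I_k -> R) (y : 'I_k -> T -> R),
    [/\ forall i, X (y i), forall i, 0 <= lam i, \sum_i lam i = 1
      & forall a, x a = \sum_i lam i * y i a].

Definition pathpoly (R : realFieldType) (n p : nat) : (arc n -> R) -> Prop :=
  conv (fun x => exists t, @is_p_path n p t /\ x = incidence R t).

Definition xsum (R : nzRingType) (n : nat) (x : arc n -> R) (F : pred (arc n)) : R :=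
  \sum_(a : arc n | F a) x a.

Definition cutset (n : nat) (S T : {set 'I_n.+1}) : pred (arc n) :=
  fun a => ((val a).1 \in S) && ((val a).2 \in T).

Definition aff_indep (R : realFieldType) (T : Type) (k : nat)
  (y : 'I_k.+1 -> T -> R) : Prop :=
  forall lam : 'I_k.+1 -> R, \sum_i lam i = 0 ->
    (forall a, \sum_i lam i * y i a = 0) -> forall i, lam i = 0.

(* dimension (of the affine hull) of a set of points: d >= -1, and a family
   of k+1 affinely independent points of the set exists iff k <= d.
   The empty set has dimension -1. *)
Definition is_dim (R : realFieldType) (T : Type) (X : (T -> R) -> Prop)
  (d : int) : Prop :=
  (-1 <= d)%R /\ forall k : nat,
    (exists y : 'I_k.+1 -> T -> R, (forall i, X (y i)) /\ aff_indep y)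
    <-> (k%:Z <= d)%R.

Definition valid_ineq (R : realFieldType) (T : finType) (P : (T -> R) -> Prop)
  (F : pred T) (b : R) : Prop :=
  forall x, P x -> b <= \sum_(a | F a) x a.

Definition face_of (R : realFieldType) (T : finType) (P : (T -> R) -> Prop)
  (F : pred T) (b : R) : (T -> R) -> Prop :=
  fun x => P x /\ \sum_(a | F a) x a = b.

Definition facet_defining (R : realFieldType) (T : finType)
  (P : (T -> R) -> Prop) (F : pred T) (b : R) : Prop :=
  valid_ineq P F b /\
  exists d : int, is_dim P d /\ is_dim (face_of P F b) (d - 1).

(* Main.v *)
Require Import Defs.
From HB Require Import structures.
From mathcomp Require Import all_boot all_order all_algebra.
From mathcomp Require Import zify ring lra.
Import Order.TTheory GRing.Theory Num.Theory.
Local Open Scope ring_scope.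
Set Implicit Arguments. Unset Strict Implicit. Unset Printing Implicit Defensive.

(** Let W := S \ {0, n}, U := V \ S, and call a path tight if it leaves S exactly
    once, that is, if its interior is a block in W, a block in U and a block
    in W.  Let c be a linear functional that is constant on tight paths.  Two
    tight paths with a common tail give the same cost to their prefixes, and
    three such exchanges show that c_ij = g + c_0j - c_0i on all interior arcs
    that do not go from U to W.  Reversing all arcs gives the same description
    through c_in and c_jn; comparing the two, c is the sum of a potential
    difference, a constant and a multiple of the cut functional.  Hence the
    vectors of the tight paths span a hyperplane in the span of all path
    vectors.  All path vectors satisfy x(A) = p, so the dimensions of the
    polytope and of the face are these ranks minus one.  If |S| = 2, the cut
    consists of the arcs leaving 0 and every path is tight. *)

(** * Costs of walks given by their node sequences *)

Section WalkCost.
Variables (R : realFieldType) (V : eqType).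
Implicit Types (c : V -> V -> R) (s t : seq V).

Fixpoint walk_cost c x s : R :=
  if s is y :: s' then c x y + walk_cost c y s' else 0.

Lemma walk_cost_cat c x s t :
  walk_cost c x (s ++ t) = walk_cost c x s + walk_cost c (last x s) t.
Proof. by elim: s x => [|y s IH] x /=; rewrite ?add0r // IH addrA. Qed.

Lemma walk_cost_rcons c x s y :
  walk_cost c x (rcons s y) = walk_cost c x s + c (last x s) y.
Proof. by rewrite -cats1 walk_cost_cat /= addr0. Qed.

(** This turns every statement about prefixes of tight paths into one about suffixes, with the cost
    function transposed. *)
Lemma walk_cost_rev c x s y :
  walk_cost c x (rcons s y) =
  walk_cost (fun i j => c j i) y (rcons (rev s) x).
Proof.
elim: s x => [|a s IH] x //=.
by rewrite IH rev_cons [RHS]walk_cost_rcons last_rcons addrC.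
Qed.

End WalkCost.

Lemma uniq_seq_in (V : finType) (Z : {set V}) k :
  (k <= #|Z|)%N -> exists s, [/\ uniq s, size s = k & {subset s <= Z}].
Proof.
move=> kZ; exists (take k (enum Z)); split.
- by rewrite take_uniq ?enum_uniq.
- by rewrite size_take -cardE; case: ltngtP kZ => // ->.
- by move=> x /mem_take; rewrite mem_enum.
Qed.

Lemma exists_notin (V : finType) (Z : {set V}) (F : seq V) :
  (size F < #|Z|)%N -> exists2 x, x \in Z & x \notin F.
Proof.
move=> FZ; have /existsP[x /andP[xZ xF]] : [exists x, (x \in Z) && (x \notin F)].
  apply: contraLR FZ; rewrite negb_exists -leqNgt => /forallP noF.
  apply: leq_trans (card_size F); apply/subset_leq_card/subsetP => x xZ.
  by have := noF x; rewrite xZ negbK.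
by exists x.
Qed.

(** * Cost functions that are constant on tight paths *)

Section Tight.
Variables (R : realFieldType) (V : finType) (W U : {set V}) (q : nat).
Implicit Types (c : V -> V -> R) (A B C : seq V).

(* A ++ B ++ C is the interior of a path that enters U exactly once. *)
Definition dip A B C : Prop :=
  [/\ {subset A <= W}, {subset B <= U}, {subset C <= W}, B != [::]
    & uniq (A ++ B ++ C) && (size (A ++ B ++ C) == q)].

(** The endpoints [z] and [e] stay arbitrary, so that reversing all arcs merely swaps them. *)
Definition flat c z e : Prop := forall A B C A' B' C',
  dip A B C -> dip A' B' C' ->
  walk_cost c z (rcons (A ++ B ++ C) e) = walk_cost c z (rcons (A' ++ B' ++ C') e).

Lemma dip_rev A B C : dip A B C -> dip (rev C) (rev B) (rev A).
Proof.
move=> [AW BU CW B0 /andP[uq sz]]; split.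
- by move=> x; rewrite mem_rev; apply: CW.
- by move=> x; rewrite mem_rev; apply: BU.
- by move=> x; rewrite mem_rev; apply: AW.
- by rewrite -size_eq0 size_rev size_eq0.
- by rewrite -!rev_cat rev_uniq size_rev -catA uq.
Qed.

Lemma flat_rev c z e : flat c z e -> flat (fun i j => c j i) e z.
Proof.
move=> fc A B C A' B' C' /dip_rev d /dip_rev d'.
rewrite [LHS]walk_cost_rev [RHS]walk_cost_rev !rev_cat -!catA.
exact: fc d d'.
Qed.

Hypothesis dWU : [disjoint W & U].
(** At least [k] nodes of the disjoint union of [W] and [U] avoid [F]. Listing the chosen nodes of
    [U] first lets the tail continue a block in [U] and then pass to [W]. *)
Lemma fresh_tail (F : seq V) k : (k + size F <= #|W| + #|U|)%N ->
  exists T C, [/\ {subset T <= U}, {subset C <= W}, uniq (T ++ C),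
    size (T ++ C) = k & forall y, y \in T ++ C -> y \notin F].
Proof.
move=> leF; pose Z := (W :|: U) :\: [set y in F].
have cZ : (k <= #|Z|)%N.
  have cWU : #|W :|: U| = (#|W| + #|U|)%N.
    by rewrite cardsU (eqP (_ : W :&: U == set0)) ?setI_eq0 // cards0 subn0.
  have cF : (#|[set y in F]| <= size F)%N by rewrite cardsE card_size.
  have := cardsD (W :|: U) [set y in F]; rewrite -/Z.
  have := subset_leq_card (subsetIr (W :|: U) [set y in F]).
  by lia.
have [s [us sz sZ]] := uniq_seq_in cZ.
pose T := [seq y <- s | y \in U]; pose C := [seq y <- s | y \in W].
have pTC : perm_eq s (T ++ C).
  rewrite -(perm_filterC (mem U) s) perm_cat2l.
  rewrite (_ : filter _ _ = C) //; apply: eq_in_filter => y /sZ.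
  rewrite !inE /= => /andP[_ /orP[yW|yU]].
    by rewrite yW (disjointFr dWU yW).
  by rewrite yU (disjointFl dWU yU).
exists T, C; split.
- by move=> y; rewrite mem_filter => /andP[].
- by move=> y; rewrite mem_filter => /andP[].
- by rewrite -(perm_uniq pTC).
- by rewrite -(perm_size pTC).
- by move=> y; rewrite -(perm_mem pTC) => /sZ; rewrite !inE => /andP[].
Qed.

Hypothesis large : (q < #|W| + #|U|)%N.

Lemma exists_dip : (0 < q)%N -> (0 < #|U|)%N -> exists A B C, dip A B C.
Proof.
move=> q0 U0; have [u uU _] := @exists_notin _ U [::] U0.
have [|T [C [TU CW uTC szTC TCF]]] := @fresh_tail [:: u] q.-1.
  by rewrite /=; lia.
exists [::], (u :: T), C; split=> //.
  by move=> y; rewrite inE => /orP[/eqP -> //|/TU].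
rewrite /= uTC szTC prednK // eqxx !andbT.
by apply/negP => /TCF; rewrite inE eqxx.
Qed.

(** Both prefixes have the same length and end in the same node [x] of [U], so one tail avoiding [F]
    completes both to tight paths, and its cost cancels. Since [W] and [U] have more than [q] nodes
    in all, [F] may have one node more than each prefix. *)
Lemma prefix_exchange c z e A B A' B' x (F : seq V) :
  flat c z e ->
  {subset A <= W} -> {subset rcons B x <= U} ->
  {subset A' <= W} -> {subset rcons B' x <= U} ->
  uniq (A ++ rcons B x) -> uniq (A' ++ rcons B' x) ->
  {subset A ++ rcons B x <= F} -> {subset A' ++ rcons B' x <= F} ->
  size (A ++ B) = size (A' ++ B') ->
  (size (A ++ B) < q)%N -> (size F <= (size (A ++ B)).+2)%N ->
  walk_cost c z (A ++ rcons B x) = walk_cost c z (A' ++ rcons B' x).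
Proof.
move=> fc AW BU A'W B'U uAB uAB' sF sF' eqs ltq leF.
have [|T [C [TU CW uTC szTC TCF]]] := @fresh_tail F (q - (size (A ++ B)).+1).
  by lia.
have mk A0 B0 : {subset A0 <= W} -> {subset rcons B0 x <= U} ->
    uniq (A0 ++ rcons B0 x) -> {subset A0 ++ rcons B0 x <= F} ->
    size (A0 ++ B0) = size (A ++ B) -> dip A0 (rcons B0 x ++ T) C.
  move=> aW bU uq sub szE; split=> //.
  - by move=> y; rewrite mem_cat => /orP[/bU //|/TU].
  - by rewrite -size_eq0 size_cat size_rcons.
  - rewrite -catA catA; apply/andP; split.
      rewrite cat_uniq uq uTC andbT /=; apply/hasPn => y yTC.
      by apply: contra (TCF _ yTC) => /sub.
    rewrite size_cat szTC; move: szE ltq.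
    by rewrite !size_cat size_rcons; lia.
have := fc _ _ _ _ _ _ (mk _ _ AW BU uAB sF erefl) (mk _ _ A'W B'U uAB' sF' (esym eqs)).
have E A0 B0 : rcons (A0 ++ (rcons B0 x ++ T) ++ C) e =
    (A0 ++ rcons B0 x) ++ rcons (T ++ C) e by rewrite -!cats1 -!catA.
rewrite !E [LHS]walk_cost_cat [RHS]walk_cost_cat !last_cat !last_rcons.
by move/addIr.
Qed.

Hypotheses (q_ge3 : (3 <= q)%N) (W_gt0 : (0 < #|W|)%N) (U_gt1 : (1 < #|U|)%N).

Lemma WU_neq i j : i \in W -> j \in U -> i != j.
Proof. by move=> iW; apply: contraTneq => <-; rewrite (disjointFr dWU iW). Qed.

(** The three exchanges compare the prefixes [s, u] with [v, u], then [s, t, u] with [s, v, u], and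
    [u, v, w] with [v, u, w]. They first give a constant for each head in [U], then show that these
    constants agree. *)
Lemma flat_forward c z e : flat c z e ->
  exists g,
    (forall u i, u \in U -> i \in W :|: U -> i != u ->
       c i u = g + c z u - c z i) /\
    (forall s t, s \in W -> t \in W -> s != t -> c s t = g + c z t - c z s).
Proof.
move=> fc.
have swap_first s u v : s \in W -> u \in U -> v \in U -> v != u ->
    c z s + c s u = c z v + c v u.
  move=> sW uU vU vu; have su := WU_neq sW uU.
  have := @prefix_exchange c z e [:: s] [::] [::] [:: v] u [:: s; v; u] fc.
  rewrite /= !addr0; apply=> //; try (by apply/allP; rewrite /= ?sW ?uU ?vU);
    try (by rewrite !inE ?andbT); try (by apply/allP; rewrite /= !inE !eqxx ?orbT).
  by lia.
have swap_second s t u v : s \in W -> t \in W -> u \in U -> v \in U ->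
    s != t -> v != u -> c s t + c t u = c s v + c v u.
  move=> sW tW uU vU st vu.
  have su := WU_neq sW uU; have tu := WU_neq tW uU; have sv := WU_neq sW vU.
  have H := @prefix_exchange c z e [:: s; t] [::] [:: s] [:: v] u [:: s; t; v; u] fc.
  rewrite /= !addr0 in H; apply: (addrI (c z s)); apply: H => //;
    try (by apply/allP; rewrite /= ?sW ?tW ?uU ?vU);
    try (by rewrite !inE ?negb_or ?andbT ?st ?su ?sv);
    try (by apply/allP; rewrite /= !inE !eqxx ?orbT).
have swap_two u v w : u \in U -> v \in U -> w \in U -> u != v -> u != w -> v != w ->
    c z u + (c u v + c v w) = c z v + (c v u + c u w).
  move=> uU vU wU uv uw vw.
  have := @prefix_exchange c z e [::] [:: u; v] [::] [:: v; u] w [:: u; v; w] fc.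
  rewrite /= !addr0; apply => //;
    try (by apply/allP; rewrite /= ?uU ?vU ?wU);
    try (by rewrite !inE ?negb_or ?andbT ?[v == u]eq_sym ?uv ?uw ?vw);
    try (by apply/allP; rewrite /= !inE !eqxx ?orbT).
have [s0 s0W _] := @exists_notin _ W [::] W_gt0.
(* [k u] is the candidate for [g] read off from the arc from [s0] to [u]. *)
pose k u := c z s0 + c s0 u - c z u.
have kE u i : u \in U -> i \in W :|: U -> i != u -> c i u = k u + c z u - c z i.
  move=> uU; rewrite inE => /orP[iW|iU] iu; last first.
    by have := swap_first _ _ _ s0W uU iU iu; rewrite /k => ?; lra.
  (* For [i] in [W] the prefixes [i, u] and [s0, u] are compared through a third one, [v, u]. *)
  have [v vU] := @exists_notin _ U [:: u] U_gt1; rewrite inE => vu.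
  have := swap_first _ _ _ s0W uU vU vu.
  by have := swap_first _ _ _ iW uU vU vu; rewrite /k => ? ?; lra.
have kW s t u v : s \in W -> t \in W -> u \in U -> v \in U -> s != t -> v != u ->
    c s t = k v + c z t - c z s.
  move=> sW tW uU vU st vu; have := swap_second _ _ _ _ sW tW uU vU st vu.
  have tu := WU_neq tW uU; have sv := WU_neq sW vU.
  rewrite (kE u t) ?(kE v s) ?(kE u v) ?inE ?sW ?tW ?vU ?orbT //.
  by move=> ?; lra.
have k_const u v : u \in U -> v \in U -> k u = k v.
  move=> uU vU; have [-> // | uv] := eqVneq u v.
  have vu : v != u by rewrite eq_sym.
  (* If [W] is a single node, then [U] has at least three nodes and [swap_two] applies. Otherwise an
     arc inside [W] gets its cost from [k u] as well as from [k v]. *)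
  have [W1 | W2] := leqP #|W| 1.
    have [|w wU] := @exists_notin _ U [:: u; v]; first by rewrite /=; lia.
    rewrite !inE negb_or ![w == _]eq_sym => /andP[uw vw].
    have := swap_two _ _ _ uU vU wU uv uw vw.
    rewrite (kE v u) ?(kE w v) ?(kE u v) ?(kE w u) ?inE ?uU ?vU ?orbT //.
    by move=> ?; lra.
  have [t tW] := @exists_notin _ W [:: s0] W2; rewrite inE eq_sym => st.
  have := kW _ _ _ _ s0W tW uU vU st vu.
  by have := kW _ _ _ _ s0W tW vU uU st uv => ? ?; lra.
have [u0 u0U _] := @exists_notin _ U [::] (ltnW U_gt1).
have [v0 v0U] := @exists_notin _ U [:: u0] U_gt1; rewrite inE => v0u0.
exists (k u0); split=> [u i uU iWU iu | s t sW tW st].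
  by rewrite (kE u i) // (k_const u u0).
by rewrite (kW s t u0 v0) // (k_const v0 u0).
Qed.

(* Comparing the two descriptions of c given by forward and backward paths
   leaves only the arcs from U to W free, and those differ by a constant mu;
   shifting the potential of U by mu moves this constant to the cut. *)
Lemma flat_potential c z e : flat c z e -> exists (P : V -> R) a b g mu,
  [/\ forall i j, i \in W :|: U -> j \in W :|: U -> i != j ->
        c i j = P j - P i + g + mu * ((i \in W) && (j \in U))%:R,
      forall j, j \in W :|: U -> c z j = P j - a + g + mu * (j \in U)%:R
    & forall i, i \in W :|: U -> c i e = b - P i + g].
Proof.
move=> fc; have [g [gU gW]] := flat_forward fc.
have [g' [gU' gW']] := flat_forward (flat_rev fc).
have [u0 u0U _] := @exists_notin _ U [::] (ltnW U_gt1).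
have [v0 v0U] := @exists_notin _ U [:: u0] U_gt1; rewrite inE => v0u0.
have [s0 s0W _] := @exists_notin _ W [::] W_gt0.
have gUU u v : u \in U -> v \in U -> u != v ->
    g + c z v - c z u = g' + c u e - c v e.
  move=> uU vU uv; have vu : v != u by rewrite eq_sym.
  by rewrite -(gU v u) ?(gU' u v) // inE ?uU ?vU orbT.
(* Adding [gUU] for [(u0, v0)] and for [(v0, u0)] cancels all costs and leaves twice each
   constant. *)
have eg : g' = g.
  have u0v0 : u0 != v0 by rewrite eq_sym.
  have := gUU _ _ u0U v0U u0v0; have := gUU _ _ v0U u0U v0u0.
  by move=> ? ?; lra.
rewrite {g'}eg in gU' gW' gUU *.
(* The sum [c z i + c i e] is constant on [U] and constant on [W]; [sg] and [ta] are its values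
   there, and [mu] will be their difference. *)
pose sg := c z u0 + c u0 e; pose ta := c z s0 + c s0 e.
have sgE u : u \in U -> c u e = sg - c z u.
  move=> uU; have [->|uu0] := eqVneq u u0; first by rewrite /sg; lra.
  by have := gUU _ _ uU u0U uu0; rewrite /sg => ?; lra.
have taE s : s \in W -> c s e = ta - c z s.
  move=> sW; have [->|ss0] := eqVneq s s0; first by rewrite /ta; lra.
  have := gW _ _ sW s0W ss0; rewrite eq_sym in ss0.
  by have := gW' _ _ s0W sW ss0; rewrite /ta => ? ?; lra.
pose mu := sg - ta.
exists (fun i => c z i - mu * (i \in U)%:R), g, (ta - g), g, mu; split.
- move=> i j; rewrite !inE => /orP[iW|iU] /orP[jW|jU] ij.
  + by rewrite (gW i j) // iW (disjointFr dWU iW) (disjointFr dWU jW) /=; lra.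
  + by rewrite (gU j i) ?inE ?iW // (disjointFr dWU iW) jU /=; lra.
  + have ji : j != i by rewrite eq_sym.
    rewrite (gU' i j) ?inE ?jW // iU (disjointFl dWU iU) (disjointFr dWU jW) /=.
    by rewrite sgE // taE // /mu; lra.
  + by rewrite (gU j i) ?inE ?iU ?orbT // jU (disjointFl dWU iU) /=; lra.
- by move=> j _; lra.
- move=> i; rewrite inE => /orP[iW|iU].
    by rewrite taE // (disjointFr dWU iW) /=; lra.
  by rewrite sgE // iU /mu /=; lra.
Qed.

End Tight.

(** * Row spaces, dimension and a facet criterion *)

Lemma submx_dual (K : fieldType) m1 m2 n (A : 'M[K]_(m1, n)) (B : 'M[K]_(m2, n)) :
  (forall v : 'cV_n, B *m v = 0 -> A *m v = 0) -> (A <= B)%MS.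
Proof.
move=> dual; rewrite submxE; apply/eqP/matrixP => i j.
move: (mulmx_coker B); move: (cokermx B) => C BC.
(* Each column of the cokernel matrix is killed by [B], hence by [A], which is the test for
   inclusion of row spaces. *)
have /dual/matrixP/(_ i 0) : B *m col j C = 0 by rewrite colE mulmxA BC mul0mx.
by rewrite colE mulmxA -colE !mxE.
Qed.

Section Dimension.
Variables (R : realFieldType) (T : finType).
Implicit Types (x y c : T -> R).

Definition point_row x : 'rV[R]_#|T| := \row_j x (enum_val j).

Lemma point_row_eq0 x : point_row x = 0 -> forall a, x a = 0.
Proof.
by move=> x0 a; have := congr1 (fun v : 'rV_ _ => v 0 (enum_rank a)) x0;
  rewrite !mxE enum_rankK.
Qed.

Lemma point_row_sum (I : finType) (lam : I -> R) (y : I -> T -> R) x :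
  (forall a, x a = \sum_i lam i * y i a) ->
  point_row x = \sum_i lam i *: point_row (y i).
Proof.
move=> xE; apply/rowP => j; rewrite mxE xE summxE.
by apply: eq_bigr => i _; rewrite !mxE.
Qed.

Lemma mul_point_row x (v : 'cV[R]_#|T|) :
  point_row x *m v = (\sum_a v (enum_rank a) 0 * x a)%:M.
Proof.
apply/rowP => i; rewrite !ord1 !mxE eqxx mulr1n (reindex (@enum_rank T)) /=.
  by apply: eq_bigr => a _; rewrite mxE enum_rankK mulrC.
by exists enum_val => a _; rewrite (enum_rankK, enum_valK).
Qed.

(* As X lies on the hyperplane h = 1, which avoids the origin, affine and
   linear independence of points of X coincide. *)
Lemma is_dim_rank (X : (T -> R) -> Prop) q (M : 'M[R]_(q, #|T|)) (h : T -> R) :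
  (forall x, X x -> (point_row x <= M)%MS) ->
  (forall i, row i M = 0 \/ exists x, X x /\ row i M = point_row x) ->
  (forall x, X x -> \sum_a h a * x a = 1) ->
  is_dim X ((\rank M)%:Z - 1).
Proof.
move=> XM MX hX; split=> [|k]; first by lia.
suff -> : (k%:Z <= (\rank M)%:Z - 1) = (k < \rank M)%N.
  split=> [[y [yX indep]] | ltk].
    pose Y := \matrix_(i < k.+1) point_row (y i).
    have YM : (Y <= M)%MS by apply/row_subP => i; rewrite rowK XM.
    apply: leq_trans (mxrankS YM); rewrite row_leq_rank.
    apply: inj_row_free => v vY0.
    have comb0 a : \sum_i v 0 i * y i a = 0.
      move: a; apply: point_row_eq0.
      rewrite (@point_row_sum _ (v 0) y) // -[RHS]vY0 mulmx_sum_row.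
      by apply: eq_bigr => i _; rewrite rowK.
    apply/rowP => i; rewrite mxE; apply: indep i => //.
    (* Applying [h] to the vanishing combination shows that its coefficients sum to 0, as affine
       independence requires. *)
    transitivity (\sum_a h a * \sum_i v 0 i * y i a); last first.
      by rewrite big1 // => a _; rewrite comb0 mulr0.
    under [RHS]eq_bigr do rewrite mulr_sumr.
    rewrite exchange_big /=; apply: eq_bigr => i _.
    rewrite -[LHS]mulr1 -(hX (y i)) // mulr_sumr.
    by apply: eq_bigr => a _; rewrite mulrCA.
  (* A maximal free family of rows of [M] contains no zero row, so all its rows are points of
     [X]. *)
  pose N := rowsub (maxrankfun M) M; have freeN : row_free N := maxrowsub_free M.
  pose g := widen_ord ltk.
  have /fin_all_exists[y yE] i : exists x, X x /\ row (g i) N = point_row x.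
    have N0 : row (g i) N != 0.
      rewrite rowE mulmx_free_eq0 //; apply/eqP => /rowP/(_ (g i))/eqP.
      by rewrite !mxE !eqxx oner_eq0.
    have rowN : row (g i) N = row (maxrankfun M (g i)) M.
      by apply/rowP => j; rewrite !mxE.
    have [r0|//] := MX (maxrankfun M (g i)); last by rewrite -rowN.
    by rewrite rowN r0 eqxx in N0.
  exists y; split=> [i | lam _ comb0 j]; first by case: (yE i).
  pose w : 'rV[R]_(\rank M) := \sum_i lam i *: delta_mx 0 (g i).
  have : w *m N = 0.
    transitivity (\sum_i lam i *: point_row (y i)).
      rewrite mulmx_suml; apply: eq_bigr => i _.
      by rewrite -scalemxAl -rowE; case: (yE i) => _ ->.
    rewrite -(@point_row_sum _ lam y (fun=> 0)) => [|a]; last by rewrite comb0.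
    by apply/rowP => a; rewrite !mxE.
  move/eqP; rewrite mulmx_free_eq0 // => /eqP/rowP/(_ (g j)).
  rewrite summxE (bigD1 j) //= big1 => [|i ij]; rewrite !mxE !eqxx /=.
    by rewrite mulr1 addr0.
  rewrite (_ : g j == g i = false) ?mulr0 //.
  by apply: contraNF ij => /eqP/(congr1 val)/= /val_inj ->.
by lia.
Qed.

Lemma is_dim_unique (X : (T -> R) -> Prop) d d' :
  is_dim X d -> is_dim X d' -> d = d'.
Proof.
move=> [d1 dX] [d1' dX'].
have E k : (k%:Z <= d)%R = (k%:Z <= d')%R.
  by apply/idP/idP => [/(dX k)/dX' | /(dX' k)/dX].
(* The instance at 0 separates the dimension -1 from the nonnegative ones. *)
have := E `|d|%N; have := E `|d'|%N; have := E 0%N; lia.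
Qed.

Variables (I : finType) (y : I -> T -> R) (X : (T -> R) -> Prop).
Hypothesis XE : forall x, X x <-> exists i, x = y i.
Variables (F : pred T).

Lemma conv_sum (c : T -> R) k (lam : 'I_k -> R) (z : 'I_k -> T -> R) x :
  (forall a, x a = \sum_i lam i * z i a) ->
  \sum_a c a * x a = \sum_i lam i * \sum_a c a * z i a.
Proof.
move=> xE; under eq_bigr do rewrite xE mulr_sumr.
rewrite exchange_big; apply: eq_bigr => i _; rewrite mulr_sumr.
by apply: eq_bigr => a _; rewrite mulrCA.
Qed.

Lemma conv_sum_cond k (lam : 'I_k -> R) (z : 'I_k -> T -> R) x :
  (forall a, x a = \sum_i lam i * z i a) ->
  \sum_(a | F a) x a = \sum_i lam i * \sum_(a | F a) z i a.
Proof.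
move=> xE; under eq_bigr do rewrite xE.
by rewrite exchange_big; apply: eq_bigr => i _; rewrite mulr_sumr.
Qed.

Lemma conv_point x : X x -> conv X x.
Proof.
move=> Xx; exists 1%N, (fun=> 1), (fun=> x); split=> //; rewrite ?big_ord1 //.
by move=> a; rewrite big_ord1 mul1r.
Qed.

Lemma conv_valid b : (forall i, b <= \sum_(a | F a) y i a) ->
  valid_ineq (conv X) F b.
Proof.
move=> yb x [k [lam [z [zX lam0 lam1 xE]]]]; rewrite (conv_sum_cond xE).
rewrite -[b]mul1r -lam1 mulr_suml; apply: ler_sum => i _.
by apply: ler_wpM2l => //; have /XE[j ->] := zX i.
Qed.

(** By the last hypothesis, a functional that vanishes on the tight points and on one further point
    off the face vanishes on all points. So that single point raises the rank of the tight ones to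
    the full rank. *)
Lemma facet_criterion (h : T -> R) :
  (forall i, \sum_a h a * y i a = 1) ->
  (forall i, 1 <= \sum_(a | F a) y i a) ->
  (exists i, \sum_(a | F a) y i a != 1) ->
  (forall c, (forall i, \sum_(a | F a) y i a = 1 -> \sum_a c a * y i a = 0) ->
     exists mu, forall i, \sum_a c a * y i a = mu * (\sum_(a | F a) y i a - 1)) ->
  facet_defining (conv X) F 1.
Proof.
move=> hy valid_y [i0 ni0] key; split; first exact: conv_valid.
pose tight i := \sum_(a | F a) y i a == 1.
pose M := \matrix_(i < #|I|) point_row (y (enum_val i)).
(* Points off the face become zero rows, which leaves the row space to the tight points. *)
pose N := \matrix_(i < #|I|)
  (if tight (enum_val i) then point_row (y (enum_val i)) else 0).
have yM i : (point_row (y i) <= M)%MS.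
  by apply: (eq_row_sub (enum_rank i)); rewrite rowK enum_rankK.
have yN i : tight i -> (point_row (y i) <= N)%MS.
  by move=> ti; apply: (eq_row_sub (enum_rank i)); rewrite rowK enum_rankK ti.
have h_conv x : conv X x -> \sum_a h a * x a = 1.
  move=> [k [lam [z [zX lam0 lam1 xE]]]]; rewrite (conv_sum h xE) -lam1.
  by apply: eq_bigr => i _; have /XE[j ->] := zX i; rewrite hy mulr1.
have dimP : is_dim (conv X) ((\rank M)%:Z - 1).
  apply: (@is_dim_rank _ _ _ h) => // [x [k [lam [z [zX _ _ xE]]]] | i].
    rewrite (point_row_sum xE); apply: summx_sub => i _; apply: scalemx_sub.
    by have /XE[j ->] := zX i.
  right; exists (y (enum_val i)); split; last by rewrite rowK.
  by apply: conv_point; apply/XE; exists (enum_val i).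
have dimF : is_dim (face_of (conv X) F 1) ((\rank N)%:Z - 1).
  apply: (@is_dim_rank _ _ _ h) => [x [[k [lam [z [zX lam0 lam1 xE]]]] xF] | i | x [/h_conv]] //.
    rewrite (point_row_sum xE); apply: summx_sub => i _.
    (* In a point of the face the weighted slacks are nonnegative with sum 0, so only tight points
       carry weight. *)
    have gap0 : \sum_i lam i * (\sum_(a | F a) z i a - 1) = 0.
      under eq_bigr do rewrite mulrBr mulr1.
      by rewrite sumrB -(conv_sum_cond xE) xF lam1 subrr.
    have gap_ge0 j : true -> 0 <= lam j * (\sum_(a | F a) z j a - 1).
      move=> _; apply: mulr_ge0 => //; rewrite subr_ge0.
      by have /XE[j' ->] := zX j.
    have /eqP := @psumr_eq0P _ _ _ _ gap_ge0 gap0 i isT.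
    rewrite mulf_eq0 => /orP[/eqP -> | ]; first by rewrite scale0r sub0mx.
    by rewrite subr_eq0; have /XE[j ->] := zX i => /yN; apply: scalemx_sub.
  rewrite rowK; case: ifP => [/eqP ti | _]; [right | by left].
  exists (y (enum_val i)); split=> //; split=> //.
  by apply: conv_point; apply/XE; exists (enum_val i).
exists ((\rank M)%:Z - 1); split=> //.
suff -> : \rank M = (\rank N).+1 by rewrite (_ : _ - 1 - 1 = (\rank N)%:Z - 1) //; lia.
(* Since [h] is 1 on all points, the slack of the inequality is a linear functional there. *)
pose gap a : R := (F a)%:R - h a.
have gapE i : \sum_a gap a * y i a = \sum_(a | F a) y i a - 1.
  under eq_bigr do rewrite mulrBl.
  rewrite sumrB hy; congr (_ - _); rewrite [RHS]big_mkcond.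
  by apply: eq_bigr => a _; case: (F a); rewrite ?mul1r ?mul0r.
have eval i (v : 'cV_#|T|) : (point_row (y i) *m v == 0) =
    (\sum_a v (enum_rank a) 0 * y i a == 0) :> bool.
  rewrite mul_point_row; apply/eqP/eqP => [/rowP/(_ 0)| -> ]; last by rewrite raddf0.
  by rewrite !mxE eqxx mulr1n.
apply/eqP; rewrite eqn_leq; apply/andP; split.
  have MN : (M <= N + point_row (y i0))%MS.
    apply: submx_dual => v Bv0.
    have sub0 m (A : 'M_(m, _)) : (A <= N + point_row (y i0))%MS -> A *m v = 0.
      by move=> /submxP[D ->]; rewrite -mulmxA Bv0 mulmx0.
    have [i /eqP/yN yiN | mu muE] := key (fun a => v (enum_rank a) 0).
      apply/eqP; rewrite -eval sub0 //.
      exact: submx_trans yiN (addsmxSl _ _).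
    have mu0 : mu = 0.
      have /eqP := sub0 _ _ (addsmxSr N (point_row (y i0))).
      rewrite eval muE mulf_eq0 subr_eq0 (negbTE ni0) orbF.
      by move/eqP.
    apply/row_matrixP => i; rewrite row_mul rowK row0; apply/eqP.
    by rewrite eval muE mu0 mul0r.
  apply: leq_trans (mxrankS MN) _; apply: leq_trans (mxrank_adds_leqif _ _) _.
  by rewrite addnC -[leqRHS]add1n leq_add2r rank_leq_row.
have NM : (N <= M)%MS.
  by apply/row_subP => i; rewrite rowK; case: ifP => _; rewrite ?sub0mx.
(* The inclusion is strict because the slack functional kills [N] but not the point [y i0]. *)
apply: rank_ltmx; rewrite /ltmx NM /=; apply: contra ni0 => MN.
have /submxP[D y0E] := submx_trans (yM i0) MN.
pose v : 'cV_#|T| := \col_j gap (enum_val j).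
have vE i : \sum_a v (enum_rank a) 0 * y i a = \sum_(a | F a) y i a - 1.
  by rewrite -gapE; apply: eq_bigr => a _; rewrite mxE enum_rankK.
have Nv : N *m v = 0.
  apply/row_matrixP => i; rewrite row_mul rowK row0; case: ifP => [ti|_].
    by apply/eqP; rewrite eval vE subr_eq0.
  by rewrite mul0mx.
have : point_row (y i0) *m v == 0 by rewrite y0E -mulmxA Nv mulmx0.
by rewrite eval vE subr_eq0.
Qed.

End Dimension.

(** * Walk costs of potentials and of cuts *)

Section WalkCostTheory.
Variables (R : realFieldType) (V : finType).
Implicit Types (c : V -> V -> R) (s : seq V) (e : rel V) (S : {set V}).

Lemma eq_walk_cost e c c' x s : (forall i j, e i j -> c i j = c' i j) ->
  path e x s -> walk_cost c x s = walk_cost c' x s.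
Proof.
by move=> cc'; elim: s x => //= y s IH x /andP[xy ys]; rewrite cc' // IH.
Qed.

Lemma walk_cost_const (k : R) x s : walk_cost (fun _ _ => k) x s = k *+ size s.
Proof. by elim: s x => //= y s IH x; rewrite IH mulrS. Qed.

(** The potential differences telescope along the walk. *)
Lemma walk_cost_potential (P : V -> R) g mu c x s :
  walk_cost (fun i j => P j - P i + g + mu * c i j) x s =
  P (last x s) - P x + g *+ size s + mu * walk_cost c x s.
Proof.
elim: s x => [|y s IH] x /=; first by rewrite mulr0n; ring.
by rewrite IH mulrS; ring.
Qed.

Definition cut_cost S i j : R := ((i \in S) && (j \notin S))%:R.

Lemma cut_cost_ge0 S x s : 0 <= walk_cost (cut_cost S) x s.
Proof. by elim: s x => //= y s IH x; rewrite addr_ge0 ?ler0n. Qed.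

Lemma cut_cost_inside S x s : {subset s <= S} -> walk_cost (cut_cost S) x s = 0.
Proof.
elim: s x => //= y s IH x sS.
rewrite {1}/cut_cost (sS y) ?mem_head //= andbF add0r IH // => z zs.
by rewrite sS // inE zs orbT.
Qed.

Lemma cut_cost_outside S x s : x \notin S -> {subset s <= ~: S} ->
  walk_cost (cut_cost S) x s = 0.
Proof.
elim: s x => //= y s IH x xS sS.
rewrite {1}/cut_cost (negbTE xS) add0r IH // => [|z zs].
  by have := sS y (mem_head y s); rewrite inE.
by rewrite sS // inE zs orbT.
Qed.

Lemma cut_cost_ge1 S x s : x \in S -> ~~ all (mem S) s ->
  1 <= walk_cost (cut_cost S) x s.
Proof.
elim: s x => //= y s IH x xS; case: (boolP (y \in S)) => yS /= sS.
  by rewrite {1}/cut_cost yS /= andbF add0r IH.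
by rewrite {1}/cut_cost xS yS lerDl cut_cost_ge0.
Qed.

End WalkCostTheory.

(** * The path polytope and its min-cut inequalities *)

Section PathPolytope.
Variables (R : realFieldType) (n : nat).
Implicit Types (c : Defs.arc n -> R) (t : seq 'I_n.+1) (S : {set 'I_n.+1}).

(** Extension by 0 to pairs that are not arcs, which leaves path costs unaffected. *)
Definition arc_cost c i j : R := oapp c 0 (insub (i, j)).

Lemma arc_costE c (a : Defs.arc n) : arc_cost c (val a).1 (val a).2 = c a.
Proof. by rewrite /arc_cost -surjective_pairing valK. Qed.

Lemma mem_zip1 (T1 T2 : eqType) (s1 : seq T1) (s2 : seq T2) i j :
  (i, j) \in zip s1 s2 -> i \in s1.
Proof.
elim: s1 s2 => [|x s1 IH] [|y s2] //=; rewrite !inE.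
by case/orP => [/eqP[-> _]|/IH ->]; rewrite ?eqxx ?orbT.
Qed.

Lemma sum_zip c x t : path (fun i j => is_arc (i, j)) x t -> uniq (x :: t) ->
  \sum_(a : Defs.arc n) c a * (if val a \in zip (x :: t) t then 1 else 0) =
  walk_cost (arc_cost c) x t.
Proof.
elim: t x => [|y t IH] x.
  by move=> _ _ /=; rewrite big1 // => a _; rewrite mulr0.
move=> /andP[xy pt] /andP[xt ut].
pose a0 : Defs.arc n := Sub (x, y) xy.
rewrite [RHS]/= -IH // (arc_costE c a0) (bigD1 a0) //= mem_head mulr1.
(* The first arc does not recur, since its tail [x] is not visited again. *)
rewrite [in RHS](bigD1 a0) //= ifF; last first.
  by apply: contraNF xt => /mem_zip1.
rewrite mulr0 add0r; congr (_ + _); apply: eq_bigr => a aa0.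
by rewrite inE -(inj_eq val_inj) /= in aa0 *; rewrite (negbTE aa0).
Qed.

Lemma sum_incidence p c t : is_p_path p t ->
  \sum_a c a * incidence R t a = walk_cost (arc_cost c) ord0 t.
Proof. by case/and4P => pt _ ut _; apply: sum_zip. Qed.

Lemma sum_cut p S t : is_p_path p t ->
  \sum_(a | cutset S (~: S) a) incidence R t a =
  walk_cost (cut_cost R S) ord0 t.
Proof.
move=> pt; rewrite big_mkcond /=.
transitivity (\sum_a (cutset S (~: S) a)%:R * incidence R t a).
  by apply: eq_bigr => a _; case: ifP; rewrite ?mul1r ?mul0r.
rewrite (sum_incidence _ pt); case/and4P: pt => pt _ _ _.
apply: eq_walk_cost pt => i j ij.
pose a : Defs.arc n := Sub (i, j) ij.
have := arc_costE (fun a => (cutset S (~: S) a)%:R) a.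
by rewrite /cut_cost /cutset SubK /= inE.
Qed.

(** The first condition rules out the absent arc from [ord0] to [ord_max]. *)
Lemma path_to_max x t : (x != ord0) || (t != [::]) ->
  uniq (x :: rcons t ord_max) -> ord0 \notin rcons t (ord_max : 'I_n.+1) ->
  path (fun i j => is_arc (i, j)) x (rcons t ord_max).
Proof.
elim: t x => [|y t IH] x /=.
  rewrite !inE orbF !andbT => x0 xm m0.
  by rewrite /is_arc /= xm eq_sym m0 negb_and x0.
move=> _ /and3P[]; rewrite !inE !mem_rcons !inE !negb_or.
move=> /and3P[xy xm _] /andP[ym yt] ut /and3P[y0 m0 t0].
have y0' : y != ord0 by rewrite eq_sym.
rewrite /is_arc /= xy y0' xm negb_and ym orbT /=.
apply: IH; rewrite ?y0' //= ?mem_rcons ?inE ?negb_or ?ym ?yt ?m0 //.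
Qed.

Lemma is_p_path_rcons t : t != [::] -> uniq (ord0 :: rcons t ord_max) ->
  is_p_path (size t).+1 (rcons t (ord_max : 'I_n.+1)).
Proof.
move=> t0 ut; rewrite /is_p_path last_rcons eqxx size_rcons eqxx ut !andbT /=.
by apply: path_to_max => //; case/andP: ut.
Qed.

Lemma is_p_path_interior p t : t != [::] -> uniq t -> (size t).+1 = p ->
  ord0 \notin t -> (ord_max : 'I_n.+1) \notin t -> (0 < n)%N ->
  is_p_path p (rcons t ord_max).
Proof.
move=> t0 ut <- z m n0; apply: is_p_path_rcons => //=.
rewrite rcons_uniq ut m mem_rcons inE negb_or z !andbT.
by rewrite -val_eqE /= neq_ltn n0.
Qed.

(** Tuples index the path vectors by a finite type, as [facet_criterion] expects. *)
Lemma path_vertices p (x : Defs.arc n -> R) :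
  (exists t, is_p_path p t /\ x = incidence R t) <->
  exists i : {t : p.-tuple 'I_n.+1 | is_p_path p t},
    x = incidence R (val (val i) : seq 'I_n.+1).
Proof.
split=> [[t [pt ->]] | [i ->]]; last by exists (val (val i)); split=> //; apply: valP i.
have szt : size t == p by case/and4P: pt.
by exists (Sub (Tuple szt) pt).
Qed.

Section Cut.
Variables (p : nat) (S : {set 'I_n.+1}).
Hypotheses (p_ge4 : (4 <= p)%N) (p_lt : (p <= n - 1)%N).
Hypotheses (S0 : ord0 \in S) (Sn : ord_max \in S).

Let W := S :\: [set ord0; ord_max].
Let U := ~: S.

Let ord0_neq_max : (ord0 : 'I_n.+1) != ord_max.
Proof. by rewrite -val_eqE /=; lia. Qed.

Let card_W : (#|W| + 2)%N = #|S|.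
Proof.
have sub : [set ord0; ord_max] \subset S.
  by apply/subsetP => i; rewrite !inE => /orP[] /eqP ->.
have c2 : #|[set ord0; ord_max : 'I_n.+1]| = 2%N by rewrite cards2 ord0_neq_max.
have := cardsD S [set ord0; ord_max]; rewrite -/W (setIidPr sub) c2.
by move=> ->; rewrite subnK // -c2; apply: subset_leq_card.
Qed.

Let card_U : (#|U| + #|S|)%N = n.+1.
Proof. by rewrite addnC cardsC card_ord. Qed.

Let disjoint_WU : [disjoint W & U].
Proof.
by rewrite -setI_eq0; apply/eqP/setP => i; rewrite !inE; case: (i \in S); rewrite ?andbF.
Qed.

Let interior i : (i \in W :|: U) = (i != ord0) && (i != ord_max).
Proof.
rewrite !inE; have [->|_] := eqVneq i ord0; first by rewrite S0.
by have [->|_] := eqVneq i ord_max; rewrite ?Sn //=; case: (i \in S).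
Qed.

(** A path has [p.+1] distinct nodes, too many to stay inside [S]. *)
Lemma cut_ge1 t : (#|S| <= p)%N -> is_p_path p t ->
  1 <= walk_cost (cut_cost R S) ord0 t.
Proof.
move=> leS /and4P[_ _ ut /eqP szt]; apply: cut_cost_ge1 => //.
apply/negP => /allP tS; have := card_uniqP ut; rewrite /= szt => ct.
suff : (p.+1 <= #|S|)%N by lia.
rewrite -ct; apply/subset_leq_card/subsetP => i; rewrite inE.
by case/orP => [/eqP -> //|/tS].
Qed.

(** Here [W] has at least [p.-1] nodes, enough for the whole interior of a path. *)
Lemma exists_path_inside : (p < #|S|)%N ->
  exists2 t, is_p_path p t & walk_cost (cut_cost R S) ord0 t = 0.
Proof.
move=> ltS; have [|s [us szs sW]] := @uniq_seq_in _ W p.-1; first by lia.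
have sI i : i \in s -> (i != ord0) && (i != ord_max).
  by move/sW => iW; rewrite -interior inE iW.
exists (rcons s ord_max).
  apply: is_p_path_interior => //; try lia.
  - by rewrite -size_eq0 szs; lia.
  - by rewrite szs; lia.
  - by apply/negP => /sI; rewrite eqxx.
  - by apply/negP => /sI; rewrite eqxx andbF.
apply: cut_cost_inside => i; rewrite mem_rcons inE => /orP[/eqP -> // | /sW].
by rewrite inE => /andP[].
Qed.

Lemma dip_path A B C : dip W U p.-1 A B C ->
  is_p_path p (rcons (A ++ B ++ C) ord_max).
Proof.
move=> [AW BU CW B0 /andP[uq /eqP sz]].
have sI i : i \in A ++ B ++ C -> (i != ord0) && (i != ord_max).
  rewrite -interior inE !mem_cat => /or3P[/AW | /BU | /CW] -> //.
  by rewrite orbT.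
apply: is_p_path_interior => //; try lia.
- by rewrite -size_eq0 sz; lia.
- by rewrite sz; lia.
- by apply/negP => /sI; rewrite eqxx.
- by apply/negP => /sI; rewrite eqxx andbF.
Qed.

Lemma dip_tight A B C : dip W U p.-1 A B C ->
  walk_cost (cut_cost R S) ord0 (rcons (A ++ B ++ C) ord_max) = 1.
Proof.
move=> [AW BU CW B0 _]; rewrite -cats1 -!catA !walk_cost_cat.
have WS i : i \in W -> i \in S by rewrite inE => /andP[].
rewrite [X in X + _]cut_cost_inside ?add0r => [|i /AW/WS //].
rewrite -walk_cost_cat [X in _ + X]cut_cost_inside ?addr0; last first.
  by move=> i; rewrite mem_cat inE => /orP[/CW/WS //|/eqP ->].
have lS : last ord0 A \in S.
  by have := mem_last ord0 A; rewrite inE => /orP[/eqP -> // | /AW/WS].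
case: B B0 BU => // b B _ BU /=.
have bS : b \notin S by have := BU b (mem_head b B); rewrite inE.
rewrite {1}/cut_cost lS bS cut_cost_outside ?addr0 // => i iB.
by apply: BU; rewrite inE iB orbT.
Qed.

(** The path starts [ord0, u, s, v] with [u], [v] in [U] and [s] in [W], so it crosses the cut on
    its first and on its third arc. *)
Lemma exists_path_cut_gt1 : (0 < #|W|)%N -> (1 < #|U|)%N ->
  exists2 t, is_p_path p t & walk_cost (cut_cost R S) ord0 t != 1.
Proof.
move=> W0 U1; have [s sW _] := @exists_notin _ W [::] W0.
have [u uU _] := @exists_notin _ U [::] (ltnW U1).
have [v vU] := @exists_notin _ U [:: u] U1; rewrite inE => vu.
pose F := [set i in [:: ord0; ord_max; u; s; v]].
have cF : (#|F| <= 5)%N by rewrite cardsE; apply: card_size.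
(* With [u], [s] and [v], these [p - 4] nodes make up the [p - 1] interior ones. *)
have [|T [uT szT TF]] := @uniq_seq_in _ (~: F) (p - 4).
  by have := cardsC F; rewrite card_ord; lia.
have su := WU_neq disjoint_WU sW uU; have sv := WU_neq disjoint_WU sW vU.
have TN i : i \in [:: ord0; ord_max; u; s; v] -> i \notin T.
  by move=> iF; apply/negP => /TF; rewrite inE in_set iF.
have I i : i \in W :|: U -> (ord0 != i) && (ord_max != i).
  by rewrite interior ![i == _]eq_sym.
have /andP[u0 um] : (ord0 != u) && (ord_max != u) by rewrite I // inE uU orbT.
have /andP[v0 vm] : (ord0 != v) && (ord_max != v) by rewrite I // inE vU orbT.
have /andP[s0 sm] : (ord0 != s) && (ord_max != s) by rewrite I // inE sW.
exists (rcons [:: u, s, v & T] ord_max).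
  apply: is_p_path_interior => //.
  - rewrite /= uT !inE !negb_or [u == s]eq_sym [u == v]eq_sym su vu sv.
    by rewrite !TN ?inE ?eqxx ?orbT.
  - by rewrite /= szT; move: p_ge4; clear; lia.
  - by rewrite !inE !negb_or u0 s0 v0 TN // inE eqxx.
  - by rewrite !inE !negb_or um sm vm TN // !inE eqxx ?orbT.
  - by move: p_ge4 p_lt; clear; lia.
have [uS vS] : u \notin S /\ v \notin S by rewrite !inE in uU vU.
have sS : s \in S by move: sW; rewrite inE => /andP[].
have uE : cut_cost R S ord0 u = 1 by rewrite /cut_cost S0 uS.
have sE : cut_cost R S u s = 0 by rewrite /cut_cost sS andbF.
have vE : cut_cost R S s v = 1 by rewrite /cut_cost sS vS.
rewrite /= uE sE vE; have := cut_cost_ge0 R S v (rcons T ord_max).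
by move: (walk_cost _ _ _) => x x0; apply/eqP; lra.
Qed.

Lemma cut_eq1_of_card2 t : #|S| = 2%N -> is_p_path p t ->
  walk_cost (cut_cost R S) ord0 t = 1.
Proof.
move=> S2 /and4P[pt _ ut /eqP szt].
have W0 i : i \in S -> i != ord0 -> i != ord_max -> False.
  move=> iS i0 im; have : i \in W by rewrite !inE negb_or i0 im.
  have : #|W| == 0%N by rewrite -(eqn_add2r 2) card_W S2.
  by rewrite cards_eq0 => /eqP ->; rewrite inE.
(* After the first arc no tail lies in [S]: the path does not return to [ord0], and no arc leaves
   [ord_max]. *)
have tail0 x s : path (fun i j => is_arc (i, j)) x s -> ord0 \notin x :: s ->
    walk_cost (cut_cost R S) x s = 0.
  elim: s x => //= y s IH x /andP[/and4P[/= _ _ xm _] ys].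
  rewrite inE negb_or eq_sym => /andP[x0 ys0].
  rewrite IH // addr0 /cut_cost; case: (boolP (x \in S)) => // xS.
  by case: (W0 x).
case: t szt pt ut => [|y t] /= szt; first by lia.
move=> /andP[/and4P[/= xy y0 _ ym] yt] /andP[y0' _].
rewrite tail0 // addr0 /cut_cost S0 /= (_ : y \notin S) //.
by apply/negP => yS; apply: (W0 y).
Qed.

Lemma potential_of_tight c : (0 < #|W|)%N -> (1 < #|U|)%N ->
  (forall t, is_p_path p t -> walk_cost (cut_cost R S) ord0 t = 1 ->
     walk_cost (arc_cost c) ord0 t = 0) ->
  exists mu, forall t, is_p_path p t ->
    walk_cost (arc_cost c) ord0 t = mu * (walk_cost (cut_cost R S) ord0 t - 1).
Proof.
move=> W0 U1 tight0.
have large : (p.-1 < #|W| + #|U|)%N by move: card_W card_U p_lt; lia.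
have dip0 A B C : dip W U p.-1 A B C ->
    walk_cost (arc_cost c) ord0 (rcons (A ++ B ++ C) ord_max) = 0.
  by move=> d; apply: tight0; [apply: dip_path | apply: dip_tight].
have fl : flat W U p.-1 (arc_cost c) ord0 ord_max.
  by move=> A B C A' B' C' d d'; rewrite !dip0.
have q3 : (3 <= p.-1)%N by move: p_ge4; clear; lia.
have [P [a [b [g [mu [cI c0 cm]]]]]] := flat_potential disjoint_WU large q3 W0 U1 fl.
(* Giving the endpoints the potentials [a] and [b] merges the three formulas of [flat_potential]
   into one. *)
pose Q i := if i == ord0 then a else if i == ord_max then b else P i.
have QI i : i \in W :|: U -> Q i = P i.
  by rewrite interior /Q => /andP[/negbTE -> /negbTE ->].
have Q0 : Q ord0 = a by rewrite /Q eqxx.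
have Qm : Q ord_max = b by rewrite /Q eq_sym (negbTE ord0_neq_max) eqxx.
have costE i j : is_arc (i, j) ->
    arc_cost c i j = Q j - Q i + g + mu * cut_cost R S i j.
  case/and4P => /= ij j0 im nij; rewrite /cut_cost.
  have [i0|i0] := eqVneq i ord0.
    have jI : j \in W :|: U by rewrite interior j0; move: nij; rewrite i0 eqxx.
    by rewrite i0 Q0 c0 // QI // S0 inE.
  have iI : i \in W :|: U by rewrite interior i0.
  have [->|jm] := eqVneq j ord_max; first by rewrite Qm cm // QI // Sn andbF mulr0 addr0.
  have jI : j \in W :|: U by rewrite interior j0.
  by rewrite cI // !QI // !inE negb_or i0 im.
have walkE t : is_p_path p t -> walk_cost (arc_cost c) ord0 t =
    b - a + g *+ p + mu * walk_cost (cut_cost R S) ord0 t.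
  case/and4P => pt /eqP lt _ /eqP szt.
  by rewrite (eq_walk_cost costE pt) walk_cost_potential lt szt Q0 Qm.
have [||A [B [C d]]] := exists_dip disjoint_WU large; [lia | exact: ltnW |].
(* A tight path has cost 0 and cut value 1, which fixes the constant. *)
have K0 : b - a + g *+ p = - mu.
  apply/eqP; rewrite -subr_eq0 opprK -[X in _ + X]mulr1 -[X in mu * X](dip_tight d).
  by rewrite -walkE ?dip0 //; apply: dip_path.
by exists mu => t pt; rewrite walkE // K0 mulrBr mulr1 addrC.
Qed.

Lemma cut_valid : (#|S| <= p)%N ->
  valid_ineq (@pathpoly R n p) (cutset S (~: S)) 1.
Proof.
move=> leS; apply: (conv_valid (path_vertices p)) => i.
by rewrite (sum_cut _ (valP i)) cut_ge1 // (valP i).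
Qed.

Lemma cut_facet : (3 <= #|S| <= p)%N ->
  facet_defining (@pathpoly R n p) (cutset S (~: S)) 1.
Proof.
case/andP => S3 Sp; have W0 : (0 < #|W|)%N by move: card_W S3; lia.
(* [U] has at least [n + 1 - p] nodes, and [p] is at most [n - 1]. *)
have U1 : (1 < #|U|)%N by move: card_U p_lt Sp; lia.
have lift t : is_p_path p t -> exists i : {t : p.-tuple 'I_n.+1 | is_p_path p t},
    val (val i) = t.
  by move=> pt; have szt : size t == p by [case/and4P: pt]; exists (Sub (Tuple szt) pt).
(* Every path has [p] arcs, so the constant weight [p%:R^-1] gives it total 1. *)
apply: (facet_criterion (path_vertices p) (h := fun=> p%:R^-1)).
- move=> i; have pt := valP i; rewrite (sum_incidence _ pt).
  case/and4P: pt => pt _ _ /eqP szt.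
  rewrite (@eq_walk_cost _ _ _ _ (fun _ _ => p%:R^-1) _ _ _ pt) => [|j k jk].
    by rewrite walk_cost_const szt -[_ *+ p]mulr_natr mulVf // pnatr_eq0 -lt0n; move: p_ge4; clear; lia.
  exact: (arc_costE (fun=> p%:R^-1) (Sub (j, k) jk : Defs.arc n)).
- by move=> i; rewrite (sum_cut _ (valP i)) cut_ge1 // (valP i).
- have [t pt ct] := exists_path_cut_gt1 W0 U1.
  have [i ti] := lift t pt; exists i.
  by rewrite ti (sum_cut _ pt).
- move=> c c0; have [|mu muE] := @potential_of_tight c W0 U1.
    move=> t pt ct; have [i ti] := lift t pt.
    by have := c0 i; rewrite ti (sum_cut _ pt) (sum_incidence _ pt); apply.
  exists mu => i; have pt := valP i.
  by rewrite (sum_incidence _ pt) (sum_cut _ pt) muE.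
Qed.

Lemma cut_valid_card : valid_ineq (@pathpoly R n p) (cutset S (~: S)) 1 ->
  (#|S| <= p)%N.
Proof.
move=> val1; rewrite leqNgt; apply/negP => /exists_path_inside[t pt ct].
have /val1 : pathpoly p (incidence R t) by apply: conv_point; exists t.
by rewrite (sum_cut _ pt) ct ler10.
Qed.

(** If [S] consists of the two endpoints, the face is the whole polytope, whose dimension cannot be
    both [d] and [d - 1]. *)
Lemma cut_facet_card : facet_defining (@pathpoly R n p) (cutset S (~: S)) 1 ->
  (3 <= #|S|)%N.
Proof.
move=> [_ [d [dimP dimF]]]; rewrite ltnNge; apply/negP => S2.
have {}S2 : #|S| = 2%N by apply/eqP; rewrite eqn_leq S2 -card_W leq_addl.
have faceE x : pathpoly p x -> face_of (@pathpoly R n p) (cutset S (~: S)) 1 x.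
  move=> Px; split=> //; case: Px => k [lam [y [yX _ lam1 xE]]].
  rewrite (conv_sum_cond _ xE) -lam1; apply: eq_bigr => i _.
  by have [t [pt ->]] := yX i; rewrite (sum_cut _ pt) cut_eq1_of_card2 // mulr1.
have dimF' : is_dim (@pathpoly R n p) (d - 1).
  case: dimF => d1 dimF; split=> // k; rewrite -dimF.
  by split=> -[y [yX ind]]; exists y; split=> // i; [apply: faceE | case: (yX i)].
by have := is_dim_unique dimP dimF'; lia.
Qed.

End Cut.

End PathPolytope.

Theorem theorem12 (R : realFieldType) (n p : nat) (S : {set 'I_n.+1}) :
  (4 <= p)%N -> (p <= n - 1)%N ->
  ord0 \in S -> ord_max \in S ->
  (valid_ineq (@pathpoly R n p) (cutset S (~: S)) 1 <-> (#|S| <= p)%N) /\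
  (facet_defining (@pathpoly R n p) (cutset S (~: S)) 1 <->
     (3 <= #|S| <= p)%N /\ (2 <= #|~: S|)%N).
Proof.
move=> p4 pn S0 Sn; split.
  by split; [apply: cut_valid_card | apply: cut_valid].
split=> [facet | [cS _]]; last exact: cut_facet.
have Sp : (#|S| <= p)%N by case: facet => valid _; apply: cut_valid_card valid.
have := cardsC S; rewrite card_ord => cSC.
split; last by move: cSC Sp pn; lia.
by rewrite Sp andbT; apply: cut_facet_card facet.
Qed.
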